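(* Let $G$ be a plane $st$-graph such that every internal face of $G$ is a rhombus. Then $G$ admits an embedding-preserving 2UBE.
   Context: Digraphs are finite, without loops and without multiple edges. A planar $st$-graph is a directed acyclic graph with a single source $s$ and a single sink $t$ that admits a planar embedding with $s$ and $t$ on the outer face; together with such an embedding it is called a plane $st$-graph. The left (right) face of an edge $e=(u,v)$ is the face to the left (right) of $e$ when moving from $u$ to $v$. The boundary of every internal face $f$ of a plane $st$-graph consists of two directed paths from a common source $s_f$ to a common sink $t_f$: the left path of $f$ consists of the boundary edges whose right face is $f$, and the right path of $f$ consists of the boundary edges whose left face is $f$. An internal face is a rhombus if each of its left path and right path consists of exactly two edges. A 2UBE (upward 2-page book embedding) of a digraph $G=(V,E)$ is a pair $\langle\pi,\sigma\rangle$, where $\pi:V\to\{1,\dots,|V|\}$ is a bijection with $\pi(u)<\pi(v)$ for every directed edge $(u,v)$, and $\sigma:E\to\{L,R\}$ assigns edges to the left or right page so that no two edges $(a,b),(c,d)$ in the same page satisfy $\pi(a)<\pi(c)<\pi(b)<\pi(d)$. Its canonical drawing $\Gamma(\pi,\sigma)$ in the plane places each vertex $v$ on a vertical line (the spine) at $y$-coordinate $\pi(v)$ and draws each edge as a circular arc in the half-plane to the left (if $\sigma(e)=L$) or to the right (if $\sigma(e)=R$) of the spine; this is a planar drawing. For a plane $st$-graph $G$, a 2UBE $\langle\pi,\sigma\rangle$ is embedding-preserving if $\Gamma(\pi,\sigma)$ has the given planar embedding of $G$ (same internal and external faces). *)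

(* Defs.v *)
From HB Require Import structures.
From mathcomp Require Import all_boot all_order all_algebra all_fingroup.

Set Implicit Arguments.
Unset Strict Implicit.
Unset Printing Implicit Defensive.

Section Combinatorics.
Variables (V : finType) (A : rel V).

Definition acyclic : Prop := forall c : seq V, path.cycle A c -> c = [::].

Definition is_source (v : V) : bool := [forall u, ~~ A u v].
Definition is_sink (v : V) : bool := [forall u, ~~ A v u].

(* Loops and antiparallel pairs are excluded by acyclicity, multiple edges by
   the encoding as a relation. *)
Definition st_graph (s t : V) : Prop :=
  [/\ acyclic, forall v, is_source v = (v == s)
    & forall v, is_sink v = (v == t)].

Definition edge := {e : V * V | A e.1 e.2}.
Definition src (e : edge) : V := (val e).1.
Definition tgt (e : edge) : V := (val e).2.

(* [(e, true)] is [e] traversed from [src e] to [tgt e]; [(e, false)] is [e]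
   traversed backwards. *)
Definition dart : Type := edge * bool.
HB.instance Definition _ := Finite.on dart.

Definition tail (d : dart) : V := if d.2 then src d.1 else tgt d.1.
Definition rev_dart (d : dart) : dart := (d.1, ~~ d.2).

Lemma rev_dart_inj : injective rev_dart.
Proof. by move=> [e b] [e' b'] [-> /negb_inj ->]. Qed.

(* [rot d] is the dart that follows [d] in counterclockwise order around the
   tail of [d]. *)
Definition rotation_system (rot : {perm dart}) : Prop :=
  forall d d' : dart, (d' \in porbit rot d) = (tail d' == tail d).

Variable rot : {perm dart}.

(* [next_on_face d] follows [d] on the boundary of the face lying to the left
   of [d]: at the head of [d], it is the dart just before the reverse of [d]
   in counterclockwise order. *)
Definition next_on_face : {perm dart} := (perm rev_dart_inj * rot^-1)%g.

(* A face is identified with the set of darts that have it on their left.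
   The embedding of the one-vertex graph has one face, without any dart. *)
Definition faces : {set {set dart}} :=
  if #|{: dart}| == 0 then [set set0] else porbits next_on_face.

Definition left_face (e : edge) : {set dart} := porbit next_on_face (e, true).
Definition right_face (e : edge) : {set dart} := porbit next_on_face (e, false).

(* The empty face only occurs in the one-vertex graph, whose vertex is on it. *)
Definition on_face (v : V) (f : {set dart}) : bool :=
  (f == set0) || [exists d in f, tail d == v].

(* An st-graph is connected, so its rotation system is that of a drawing in the
   plane iff Euler's formula holds. The drawing is then determined, up to an
   orientation-preserving homeomorphism of the plane, by the choice of the
   outer face. *)
Definition plane_st_graph (s t : V) (outer : {set dart}) : Prop :=
  [/\ st_graph s t,
      rotation_system rot,
      #|V| + #|faces| = #|{: edge}| + 2,
      outer \in faces
    & on_face s outer /\ on_face t outer].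

Definition left_path (f : {set dart}) : {set edge} :=
  [set e | right_face e == f].
Definition right_path (f : {set dart}) : {set edge} :=
  [set e | left_face e == f].

Definition rhombus (f : {set dart}) : Prop :=
  #|left_path f| = 2 /\ #|right_path f| = 2.

End Combinatorics.

Inductive page := Lpage | Rpage.

(* The values of [pi] are numbered from 0. *)
Definition is_2UBE (V : finType) (A : rel V)
    (pi : V -> 'I_#|V|) (sigma : edge A -> page) : Prop :=
  [/\ bijective pi,
      forall u v, A u v -> pi u < pi v
    & forall e e' : edge A, sigma e = sigma e' ->
        ~ [/\ pi (src e) < pi (src e'), pi (src e') < pi (tgt e)
            & pi (tgt e) < pi (tgt e')]].

From mathcomp Require Import all_classical all_reals all_analysis.
Import Order.TTheory GRing.Theory Num.Theory.
Import numFieldNormedType.Exports.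

Section CanonicalDrawing.
Local Open Scope classical_set_scope.
Local Open Scope ring_scope.
Variables (R : realType) (V : finType) (A : rel V).
Variables (pi : V -> 'I_#|V|) (sigma : edge A -> page).

Definition height (v : V) : R := (pi v).+1%:R.
Definition vertex_point (v : V) : R * R := (0, height v).

Definition sqdist (p q : R * R) : R := (p.1 - q.1) ^+ 2 + (p.2 - q.2) ^+ 2.

Definition arc_center (e : edge A) : R * R :=
  (0, (height (src e) + height (tgt e)) / 2).
Definition arc_radius (e : edge A) : R := (height (tgt e) - height (src e)) / 2.

Definition edge_arc (e : edge A) : set (R * R) :=
  [set p | sqdist p (arc_center e) = arc_radius e ^+ 2 /\
           if sigma e is Lpage then p.1 <= 0 else 0 <= p.1].

Definition drawing : set (R * R) := range vertex_point `|` \bigcup_e edge_arc e.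

(* For three points of a circle: met in the order p, q, r when the circle is
   traversed counterclockwise. *)
Definition ccw (p q r : R * R) : Prop :=
  0 < (q.1 - p.1) * (r.2 - p.2) - (q.2 - p.2) * (r.1 - p.1).

(* All arcs are orthogonal to the spine at their endpoints, so their order
   around a vertex is read on small circles centred at the vertex: no third
   arc is met on the way, counterclockwise, from [d] to [rot d]. *)
Definition rotation_of_drawing (rot : {perm dart A}) : Prop :=
  forall d d' : dart A, tail d' = tail d -> d' <> d -> d' <> rot d ->
  \forall eps \near (0 : R)^'+, forall p q r : R * R,
    sqdist p (vertex_point (tail d)) = eps ^+ 2 -> edge_arc d.1 p ->
    sqdist q (vertex_point (tail d)) = eps ^+ 2 -> edge_arc (rot d).1 q ->
    sqdist r (vertex_point (tail d)) = eps ^+ 2 -> edge_arc d'.1 r ->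
    ccw p q r.

(* The side of the circle supporting the arc of [d] that is to the left of the
   arc when it is traversed in the direction of [d]: the inside for a right arc
   going up or a left arc going down, the outside otherwise. *)
Definition left_side (d : dart A) : set (R * R) :=
  [set q | match sigma d.1, d.2 with
           | Rpage, true | Lpage, false =>
               sqdist q (arc_center d.1) < arc_radius d.1 ^+ 2
           | Rpage, false | Lpage, true =>
               arc_radius d.1 ^+ 2 < sqdist q (arc_center d.1)
           end].

(* The faces of the drawing, as subsets of the plane, are the connected
   components of its complement. *)
Definition in_external_region : set (R * R) :=
  [set q | ~ bounded_set (connected_component (~` drawing) q)].

Definition external_on_left (d : dart A) : Prop :=
  exists p : R * R, [/\ edge_arc d.1 p, p.1 != 0
    & \forall q \near p, left_side d q -> in_external_region q].

(* All the darts of a face of the drawing have the same region on their left,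
   hence the test on a single dart. *)
Definition external_face (f : {set dart A}) : Prop :=
  f = finset.set0 \/ exists2 d, d \in f & external_on_left d.

(* Sharing the rotation system amounts to sharing the boundary walks of all
   faces. *)
Definition embedding_preserving (rot : {perm dart A}) (outer : {set dart A}) :
  Prop := rotation_of_drawing rot /\ external_face outer.

End CanonicalDrawing.

(* Main.v *)
(** The boundary of a face is never a directed cycle, so it changes direction at
    least twice, and around every vertex other than s and t the darts switch at
    least twice between incoming and outgoing ones.  Counting the corners of
    the embedding by the directions of their two darts, Euler's formula turns
    all these bounds into equalities: every internal face is a directed
    quadrilateral, and every vertex v other than s and t has a unique face on
    its right, whose rightmost vertex, if the face is internal, is the right
    neighbour of v.  Starting from the left boundary of the graph, this
    organises the vertices into levels, ordered from left to right, such that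
    edges join consecutive levels without crossing.  The spine traverses the
    levels bottom up, even ones from left to right and odd ones from right to
    left; the edges leaving even (odd) levels go to the left (right) page. *)
Require Import Defs.
From mathcomp Require Import all_boot all_order all_algebra all_fingroup.
From mathcomp Require Import zify.
From mathcomp Require Import reals.

Set Implicit Arguments.
Unset Strict Implicit.
Unset Printing Implicit Defensive.

(** * The faces and vertices of a plane st-graph *)

Lemma porbit_closed (T : finType) (p : {perm T}) (P : pred T) (x y : T) :
    (forall z, z \in porbit p x -> P z -> P (p z)) ->
  P x -> y \in porbit p x -> P y.
Proof.
move=> cP Px /porbitP[i ->]; elim: i => [|i IH]; first by rewrite expg0 perm1.
by rewrite expgSr permM; apply: cP => //; apply: mem_porbit.
Qed.

(** If [P] never turned false along [p], it would spread from [x] over the whole orbit and reach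
    [y]. *)
Lemma porbit_switch (T : finType) (p : {perm T}) (P : pred T) (x y z : T) :
    x \in porbit p z -> y \in porbit p z -> P x -> ~~ P y ->
  exists2 w, w \in porbit p z & P w && ~~ P (p w).
Proof.
move=> xz yz Px nPy; move: xz yz; rewrite -!eq_porbit_mem => /eqP <- /eqP pxy.
have [//|none] := boolP [exists w in porbit p x, P w && ~~ P (p w)].
  by case/exists_inP => w; exists w.
have yx : y \in porbit p x by rewrite -eq_porbit_mem pxy.
case/negP: nPy; apply: (porbit_closed _ Px yx).
move=> w wx Pw; apply: contraNT none => nP.
by apply/exists_inP; exists w => //; rewrite Pw.
Qed.

Lemma porbit_step (T : finType) (p : {perm T}) (x : T) :
  porbit p (p x) = porbit p x.
Proof. by have := porbit_perm p 1 x; rewrite expg1. Qed.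

Lemma cycle_porbit (T : finType) (p : {perm T}) (x : T) :
  path.cycle (frel p) (traject p x #|porbit p x|).
Proof.
case Dn: #|porbit p x| => [|k] //=.
rewrite rcons_path fpath_traject /= last_traject.
by rewrite -iterS -Dn iter_porbit eqxx.
Qed.

Lemma acyclic_ind (V : finType) (A : rel V) (P : V -> Prop) :
  acyclic A -> (forall v, (forall u, A u v -> P u) -> P v) -> forall v, P v.
Proof.
move=> acA step v.
have path_uniq x p : path A x p -> uniq (x :: p).
  elim: p x => //= y p IH x /andP[Axy /[dup] yp /IH ->]; rewrite andbT.
  have : path A x (y :: p) by rewrite /= Axy.
  apply: contraTN => xp; case/splitPr: {yp} xp => p1 p2; apply/negP.
  by rewrite -cat_rcons cat_path => /andP[/(acA (x :: p1))].
(* The vertices of the path [x :: p] are distinct, so [n] bounds how many predecessors can still be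
   put in front of it. *)
suff walk n x p : path A x p -> #|V| <= size p + n -> P x.
  by apply: (walk #|V| v [::]); rewrite ?add0n.
elim: n x p => [|n IH] x p xp len.
  have := max_card (mem (x :: p)); rewrite (card_uniqP (path_uniq _ _ xp)) /=.
  by rewrite addn0 in len; rewrite ltnNge len.
apply: step => u Aux; apply: (IH u (x :: p)); first by rewrite /= Aux.
by rewrite addSnnS.
Qed.

Definition head (V : finType) (A : rel V) (d : dart A) := tail (rev_dart d).

(* If [x] is the position of each vertex in its level, this compares two darts
   at a vertex in counterclockwise order, the outgoing ones, from right to left,
   before the incoming ones, from left to right. *)
Definition ccw_step (V : finType) (A : rel V) (x : V -> nat) (d d' : dart A) :=
  match d.2, d'.2 with
  | true, true => x (head d') < x (head d)
  | false, false => x (head d) < x (head d')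
  | b, _ => b
  end.

Section PlaneGraph.
Variables (V : finType) (A : rel V) (s t : V).
Variables (rot : {perm dart A}) (outer : {set dart A}).
Hypothesis plane : plane_st_graph rot s t outer.

Local Notation next := (next_on_face rot).
Local Notation prev := (next_on_face rot)^-1%g.

Lemma rev_dartK : involutive (@rev_dart V A).
Proof. by case=> e b; rewrite /rev_dart negbK. Qed.

Lemma rot_next d : rot (next d) = rev_dart d.
Proof. by rewrite permM permKV permE. Qed.

Lemma rotE d : rot d = rev_dart (prev d).
Proof. by rewrite -rot_next permKV. Qed.

Lemma rot2E d : (rot d).2 = ~~ (prev d).2.
Proof. by rewrite rotE. Qed.

Lemma tail_rot d : tail (rot d) = tail d.
Proof.
case: plane => _ R _ _ _.
by apply/eqP; rewrite -R -(porbit_perm rot 1) expg1 porbit_id.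
Qed.

Lemma tail_next d : tail (next d) = head d.
Proof. by rewrite -tail_rot rot_next. Qed.

Lemma head_rev (d : dart A) : head (rev_dart d) = tail d.
Proof. by rewrite /head rev_dartK. Qed.

Lemma head_prev d : head (prev d) = tail d.
Proof. by rewrite -tail_next permKV. Qed.

Lemma dart_edge (d : dart A) : if d.2 then A (tail d) (head d) else A (head d)
  (tail d).
Proof. by case: d => [[[u v] /= Auv] []]. Qed.

Lemma st_acyclic : acyclic A. Proof. by case: plane => [[]]. Qed.

Lemma source_dart (d : dart A) : tail d = s -> d.2.
Proof.
move=> ds; case: plane => [[_ /(_ s) + _]] _ _ _ _;
  rewrite eqxx => /forallP/(_ (head d)).
by have := dart_edge d; case: d.2 => //; rewrite ds => ->.
Qed.

Lemma sink_dart (d : dart A) : tail d = t -> ~~ d.2.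
Proof.
move=> dt; case: plane => [[_ _ /(_ t) +]] _ _ _ _;
  rewrite eqxx => /forallP/(_ (head d)).
by have := dart_edge d; case: d.2 => //; rewrite dt => ->.
Qed.

Lemma ex_in v : v != s -> exists2 d : dart A, tail d = v & ~~ d.2.
Proof.
case: plane => [[_ /(_ v) + _]] _ _ _ _ => <- /forallPn[u /negPn Auv].
by exists (exist _ (u, v) Auv : edge A, false).
Qed.

Lemma ex_out v : v != t -> exists2 d : dart A, tail d = v & d.2.
Proof.
case: plane => [[_ _ /(_ v) +]] _ _ _ _ => <- /forallPn[u /negPn Auv].
by exists (exist _ (v, u) Auv : edge A, true).
Qed.

(* A face whose darts all had the same direction would be a directed cycle. *)
Lemma face_mixed d b : exists2 d', d' \in porbit next d & d'.2 == b.
Proof.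
have [//|none] := boolP [exists d' in porbit next d, d'.2 == b].
  by case/exists_inP => w; exists w.
have all_b d' : d' \in porbit next d -> d'.2 = ~~ b.
  move=> d'd; apply: contraNeq none => nb; apply/exists_inP; exists d' => //.
  by move: nb; case: d'.2; case: b.
have Dk : traject next d #|porbit next d| != [::].
  by rewrite -size_eq0 size_traject card_porbit_neq0.
have: path.cycle [rel x y | if b then A y x else A x y]
        (map (@tail V A) (traject next d #|porbit next d|)).
  apply: (homo_cycle_in (P := porbit next d) _ _ (cycle_porbit next d)).
    move=> x y xd _ /eqP <-; rewrite /= tail_next.
    by have := dart_edge x; rewrite (all_b x xd); case: (b).
  by apply/allP => x; rewrite -porbit_traject.
have nil c : path.cycle [rel x y | if b then A y x else A x y] c -> c = [::].
  case: (b) => cc; last exact: st_acyclic.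
  by apply: (can_inj revK); apply: st_acyclic; rewrite rev_cycle.
by move/nil/eqP; rewrite -size_eq0 size_map size_eq0 (negPf Dk).
Qed.

(* [corner a b] represents the angle between [d] and [rot d] by [d], which has
   the face containing this angle on its left. *)
Definition corner a b := [set d : dart A | (d.2 == a) && ((rot d).2 == b)].

Lemma card_corners : #|{: dart A}| =
  #|corner true true| + #|corner false false| + #|corner true false|
  + #|corner false true|.
Proof.
have E (B : {set dart A}) : #|B| = \sum_(d : dart A) (d \in B).
  by rewrite -sum1_card big_mkcond; apply: eq_bigr => d _; case: (_ \in _).
rewrite -cardsT !E -!big_split /=.
by apply: eq_bigr => d _; rewrite !inE; case: d.2; case: (rot d).2.
Qed.

(** The boundary walk switches somewhere from direction [~~ b] to [b]. If this happens after [z],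
    then [rot (next z) = rev_dart z] has direction [b] as well. *)
Lemma face_corner d b : exists2 d', d' \in porbit next d & d' \in corner b b.
Proof.
have [x xd xb] := face_mixed d (~~ b); have [y yd yb] := face_mixed d b.
have [] := @porbit_switch _ next (fun z => z.2 == ~~ b) x y d xd yd xb.
  by rewrite (eqP yb); case: (b).
move=> z zd zb; exists (next z).
  by rewrite -eq_porbit_mem porbit_step eq_porbit_mem.
by rewrite inE rot_next /=; move: zb; case: z.2; case: (next z).2; case: (b).
Qed.

Lemma mem_porbit_rot d d' : (d' \in porbit rot d) = (tail d' == tail d).
Proof. by case: plane => _ R _ _ _; apply: R. Qed.

Lemma vertex_corner v b : v != s -> v != t ->
  exists2 d, tail d = v & d \in corner b (~~ b).
Proof.
move=> vs vt.
have [x xv xo] := ex_out vt; have [y yv yo] := ex_in vs.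
have yx : y \in porbit rot x by rewrite mem_porbit_rot xv yv.
have [] := @porbit_switch _ rot (fun z => z.2 == b) (if b then x else y)
  (if b then y else x) x.
- by case: (b); rewrite ?porbit_id.
- by case: (b); rewrite ?porbit_id.
- by case: (b); rewrite ?xo ?(negPf yo).
- by case: (b); rewrite ?xo ?(negPf yo).
move=> z zx zb; exists z; first by apply/eqP; rewrite -xv -mem_porbit_rot.
by rewrite inE; move: zb; case: z.2; case: (rot z).2; case: (b).
Qed.

(** * Euler's formula and the number of corners of each kind *)

Section Nontrivial.
Variable d_ : dart A.

Lemma facesE : faces rot = porbits next.
Proof. by rewrite /faces; case: eqP => // /card0_eq /(_ d_); rewrite inE. Qed.

Lemma outer_porbit d : (d \in outer) = (outer == porbit next d).
Proof.
case: plane => _ _ _ + _; rewrite facesE => /imsetP[x _ ->].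
by rewrite eq_sym eq_porbit_mem.
Qed.

Lemma outer_dart v : on_face v outer -> exists2 d, d \in outer & tail d = v.
Proof.
case/orP => [/eqP o0 | /exists_inP[d]]; last by move=> ? /eqP; exists d.
case: plane => _ _ _ + _; rewrite facesE => /imsetP[x _ ox].
by have := porbit_id next x; rewrite -ox o0 inE.
Qed.

(** Every face has corners of both kinds [b b], and every vertex other than [s] and [t] has corners
    of both kinds [b (~~ b)]. This makes at least 2F + 2(V - 2) = 2E corners; as there are only 2E
    darts, all the bounds are attained. *)
Lemma corner_counts :
  [/\ forall b, #|corner b b| = #|[set porbit next d | d in corner b b]|
    & forall b, #|corner b (~~ b)| = #|[set tail d | d in corner b (~~ b)]| ].
Proof.
have Euler : #|V| + #|porbits next| = #|{: edge A}| + 2.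
  by case: plane => _ _ + _ _; rewrite facesE.
have cd : #|{: dart A}| = #|{: edge A}| * 2 by rewrite card_prod card_bool.
have cf b : #|porbits next| <= #|[set porbit next d | d in corner b b]|.
  apply/subset_leq_card/subsetP => f /imsetP[d _ ->].
  have [d' d'd d'c] := face_corner d b; apply/imsetP; exists d' => //.
  by apply/esym/eqP; rewrite eq_porbit_mem.
have cv b : #|V| - 2 <= #|[set tail d | d in corner b (~~ b)]|.
  rewrite -cardsT; apply: (@leq_trans #|[set: V] :\: [set s; t]|).
    by rewrite cardsD setTI leq_sub2l // cards2; case: eqP.
  apply/subset_leq_card/subsetP => v;
    rewrite !inE andbT negb_or => /andP[vs vt].
  by have [d dv dc] := vertex_corner b vs vt; apply/imsetP; exists d.
have le b : #|[set porbit next d | d in corner b b]| <= #|corner b b|.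
  exact: leq_imset_card.
have le' b : #|[set tail d | d in corner b (~~ b)]| <= #|corner b (~~ b)|.
  exact: leq_imset_card.
have squeeze (v f e a b c d a' b' c' d' : nat) :
    v + f = e + 2 -> e * 2 = a + b + c + d ->
    f <= a' -> f <= b' -> v - 2 <= c' -> v - 2 <= d' ->
    a' <= a -> b' <= b -> c' <= c -> d' <= d ->
  [/\ a = a', b = b', c = c' & d = d'] by split; lia.
have [oo ii oi io] := squeeze _ _ _ _ _ _ _ _ _ _ _ Euler
  (etrans (esym cd) card_corners) (cf true) (cf false) (cv true) (cv false)
  (le true) (le false) (le' true) (le' false).
by split=> -[].
Qed.

Lemma face_corner_inj b d d' : d \in corner b b -> d' \in corner b b ->
  d' \in porbit next d -> d = d'.
Proof.
move=> dc dc' dd'; have /(_ b) cc := corner_counts.1.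
have /imset_injP inj : #|[set porbit next d | d in corner b b]| == #|corner b
  b|.
  by rewrite -cc.
by apply: inj => //; apply/esym/eqP; rewrite eq_porbit_mem.
Qed.

Lemma vertex_corner_inj b d d' :
    d \in corner b (~~ b) -> d' \in corner b (~~ b) ->
  tail d = tail d' -> d = d'.
Proof.
move=> dc dc' dd'; have /(_ b) cc := corner_counts.2.
have /imset_injP inj : #|[set tail d | d in corner b (~~ b)]| == #|corner b (~~
  b)|.
  by rewrite -cc.
exact: inj.
Qed.

(** * Boundary walks of the rhombi and of the outer face *)

Hypothesis rhomb : forall f, f \in faces rot -> f <> outer -> rhombus rot f.

Lemma cornerE d a b : (d \in corner a b) = (d.2 == a) && ((prev d).2 == ~~ b).
Proof. by rewrite inE rot2E; case: (prev d).2; case: (b). Qed.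

Lemma mem_next f d : f \in porbits next -> (next d \in f) = (d \in f).
Proof.
case/imsetP => x _ ->.
by rewrite -!eq_porbit_mem porbit_step.
Qed.

Lemma outer_face : outer \in porbits next.
Proof. by case: plane => _ _ _ + _; rewrite facesE. Qed.

Lemma outer_next d : (next d \in outer) = (d \in outer).
Proof. exact: mem_next outer_face. Qed.

(** By [face_corner_inj], the boundary switches to direction [b] only at [d]. The second dart of
    direction [b] is thus preceded by a dart of direction [b], which has to be [d]. *)
Lemma rhombus_run b d : d \in corner b b -> d \notin outer ->
  [/\ (next d).2 = b, next d <> d, (next (next d)).2 = ~~ b
    & forall d', d' \in porbit next d -> d'.2 = b -> d' = d \/ d' = next d].
Proof.
move=> dc dout; set f := porbit next d.
have ff : f \in porbits next by apply: imset_f.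
have card2 : #|[set e | porbit next (e, b) == f]| = 2.
  have [|fo|] := rhomb (f := f); first by rewrite facesE.
    by rewrite -fo porbit_id in dout.
  by rewrite /left_path /right_path /left_face /right_face; case: (b).
have d2 : d.2 = b by move: dc; rewrite cornerE => /andP[/eqP].
have pd2 : (prev d).2 = ~~ b by move: dc; rewrite cornerE => /andP[_ /eqP].
have d1 : d.1 \in [set e | porbit next (e, b) == f].
  by rewrite inE -{1}d2 -surjective_pairing.
have /eqP/cards1P[e2 De2] : #|[set e | porbit next (e, b) == f] :\ d.1| = 1.
  by move: card2; rewrite (cardsD1 d.1) d1 => -[].
have only d' : d' \in f -> d'.2 = b -> d' = d \/ d' = (e2, b).
  move=> d'f d'b; have [e1|ne] := eqVneq d'.1 d.1.
    by left; rewrite [d']surjective_pairing e1 d'b -d2 -surjective_pairing.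
  right; have : d'.1 \in [set e2].
    by rewrite -De2 !inE ne -d'b -surjective_pairing eq_porbit_mem.
  by rewrite inE => /eqP <-; rewrite -d'b -surjective_pairing.
have : e2 \in [set e2] by rewrite inE.
rewrite -De2 !inE eq_porbit_mem; set x := (e2, b) => /andP[e2d xf].
have xd : x <> d by move=> xd; rewrite -xd eqxx in e2d.
(* A dart fixed by [next] is alone on its face, which contradicts [x <> d]. *)
have fixed y : y \in f -> next y = y -> d = y /\ x = y.
  move=> yf ny; have fy : f = porbit next y.
    by apply/esym/eqP; rewrite eq_porbit_mem.
  have all_y z : z \in f -> z = y.
    rewrite fy => zy.
    apply/eqP; apply: (porbit_closed (P := pred1 y) _ _ zy) => //= w _ /eqP ->.
    by rewrite ny.
  by split; apply: all_y; rewrite ?porbit_id.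
have px2 : (prev x).2 = b.
  have [//|pxb] := eqVneq (prev x).2 b; case: xd.
  apply/esym/(@face_corner_inj b) => //; rewrite cornerE eqxx /=.
  by move: pxb; case: (prev x).2; case: (b).
have pxf : prev x \in f by rewrite -(mem_next _ ff) permKV.
have nd : next d = x.
  have [<-|px] := only _ pxf px2; first by rewrite permKV.
  have nx : next x = x by rewrite -[RHS](permKV next) px.
  by case: xd; have [<-] := fixed x xf nx.
split; rewrite ?nd //.
have [//|nx2] := eqVneq (next x).2 (~~ b); case: xd.
have nxf : next x \in f by rewrite mem_next.
have nxb : (next x).2 = b by move: nx2; case: (next x).2; case: (b).
have [nx|nx] := only (next x) nxf nxb.
- have nb : b <> ~~ b by case: (b).
  by case: nb; rewrite -pd2 -nx permK.
- by have [] := fixed x xf nx => ->.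
Qed.

Lemma rhombusP d : d \in corner true true -> d \notin outer ->
  [/\ (next d).2, ~~ (next (next d)).2, ~~ (next (next (next d))).2,
      next (next (next (next d))) = d
    & forall d', d' \in porbit next d ->
        [\/ d' = d, d' = next d, d' = next (next d) | d' = next (next (next
          d))]].
Proof.
move=> dc dout; have [d2 d21 /negbT d3 Td] := rhombus_run dc dout.
have d3c : next (next d) \in corner false false.
  by rewrite cornerE permK d2 (negPf d3).
have d3out : next (next d) \notin outer by rewrite !outer_next.
have [d4 d43 d5 Fd] := rhombus_run d3c d3out.
rewrite !porbit_step in Fd.
have nd4 : next (next (next (next d))) = d.
  have [| |//|nd] := Td (next (next (next (next d))));
    first by rewrite -eq_porbit_mem !porbit_step.
  - by rewrite d5.
  - have/perm_inj n3 := nd; move: d4; rewrite n3.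
    by move: dc; rewrite cornerE => /andP[/eqP ->].
split=> //; first by rewrite d4.
move=> d' d'f; case d'2: d'.2.
  by have [->|->] := Td d' d'f d'2; [constructor 1|constructor 2].
by have [->|->] := Fd d' d'f d'2; [constructor 3|constructor 4].
Qed.

(** The walk keeps the rhombus on its left: [d] starts at the source, and [next d], [next (next d)],
    [prev d] start at the right vertex, the sink and the left vertex. *)
Lemma rhombus_corners d : d \in corner true true -> d \notin outer ->
  [/\ prev d \in corner false true, next d \in corner true false,
      next (next d) \in corner false false & next (next (next d)) = prev d].
Proof.
move=> dc dout; have [d2 d3 d4 nd _] := rhombusP dc dout.
have pd : next (next (next d)) = prev d by rewrite -{2}nd permK.
have [d1 p1] : d.2 /\ ~~ (prev d).2.
  by move: dc; rewrite cornerE => /andP[/eqP -> /eqP ->].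
split=> //; rewrite !cornerE ?permK ?d1 ?d2 ?(negPf d3) ?(negPf p1) //.
by rewrite -pd permK (negPf d3).
Qed.

Lemma rhombus_dart d : d \notin outer -> exists d1,
  [/\ d1 \in corner true true, d1 \notin outer
    & [\/ d = d1, d = next d1, d = next (next d1) | d = prev d1]].
Proof.
move=> dout; have [d1 d1d d1c] := face_corner d true.
have dd1 : porbit next d1 = porbit next d by apply/eqP; rewrite eq_porbit_mem.
have d1out : d1 \notin outer by rewrite outer_porbit dd1 -outer_porbit.
exists d1; split=> //; have [_ _ _ nd] := rhombusP d1c d1out.
have [_ _ _ <-] := rhombus_corners d1c d1out.
by apply; rewrite -eq_porbit_mem dd1.
Qed.

Lemma corner_inj d a b a' b' : d \in corner a b -> d \in corner a' b' ->
  a = a' /\ b = b'.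
Proof. by rewrite !inE => /andP[/eqP <- /eqP <-] /andP[/eqP -> /eqP ->]. Qed.

(** Of the four corners of a rhombus, only the one at its right vertex turns counterclockwise from
    an outgoing to an incoming dart. *)
Lemma oi_rhombus d : d \in corner true false -> d \notin outer ->
  prev d \in corner true true /\ prev d \notin outer.
Proof.
move=> dc /rhombus_dart[d1 [c1 o1]]; have [c4 _ c3 _] := rhombus_corners c1 o1.
case=> Dd; rewrite Dd in dc *; rewrite ?permK //.
- by have [] := corner_inj dc c1.
- by have [] := corner_inj dc c3.
- by have [] := corner_inj dc c4.
Qed.

Lemma ii_rhombus d : d \in corner false false -> d \notin outer ->
  prev (prev d) \in corner true true /\ prev (prev d) \notin outer.
Proof.
move=> dc /rhombus_dart[d1 [c1 o1]]; have [c4 c2 _ _] := rhombus_corners c1 o1.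
case=> Dd; rewrite Dd in dc *; rewrite ?permK //.
- by have [] := corner_inj dc c1.
- by have [] := corner_inj dc c2.
- by have [] := corner_inj dc c4.
Qed.

Lemma outer_same d d' : d \in outer -> d' \in outer -> d' \in porbit next d.
Proof. by rewrite -eq_porbit_mem !outer_porbit => /eqP <- /eqP <-. Qed.

(** The outer face has a single corner of kind [b b]. It also has a corner at [s] and one at [t],
    where all corners are of kind [true true] and [false false] respectively. *)
Lemma outer_corner b d : d \in corner b b -> d \in outer ->
  tail d = if b then s else t.
Proof.
move=> dc dout; case: plane =>
  _ _ _ _ [/outer_dart[x xo xs] /outer_dart[y yo yt]].
have same z := @outer_same d z dout.
case: b dc => dc.
  rewrite (face_corner_inj dc _ (same x xo)) // inE source_dart //.
  by rewrite source_dart // tail_rot.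
rewrite (face_corner_inj dc _ (same y yo)) // inE (negPf (sink_dart yt)).
by rewrite (negPf (@sink_dart (rot y) _)) // tail_rot.
Qed.

Lemma source_corner d : tail d = s -> d \in corner true true.
Proof. by move=> ds; rewrite inE !source_dart ?tail_rot. Qed.

Lemma sink_corner d : tail d = t -> d \in corner false false.
Proof.
by move=> dt; rewrite inE (negPf (sink_dart dt)) (negPf (@sink_dart (rot d) _))
  ?tail_rot.
Qed.

Lemma outer_corner_inj b d d' : d \in corner b b -> d \in outer ->
  d' \in corner b b -> d' \in outer -> d = d'.
Proof.
move=> dc dout d'c d'o; exact: face_corner_inj dc d'c (outer_same dout d'o).
Qed.

(** Both darts are either the unique corner [true true] of the outer face, at [s], or the unique
    corner [true false] at their common tail. *)
Lemma outer_out_inj d d' : d \in outer -> d' \in outer -> d.2 -> d'.2 ->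
  tail d = tail d' -> d = d'.
Proof.
move=> dout d'out d1 d'1 dd'; case r: (rot d).2.
  have dc : d \in corner true true by rewrite inE d1 r.
  have ds := outer_corner dc dout.
  by apply: outer_corner_inj dc _ _ _ => //; apply: source_corner; rewrite -dd'.
case r': (rot d').2.
  have dc : d' \in corner true true by rewrite inE d'1 r'.
  have ds := outer_corner dc d'out.
  apply/esym; apply: outer_corner_inj dc _ _ _ => //.
  by apply: source_corner; rewrite dd'.
by apply: (@vertex_corner_inj true); rewrite // inE ?d1 ?d'1 ?r ?r'.
Qed.

(* [u] and [w] are the left and right vertices of the same internal face. *)
Definition right_neighbor (u w : V) : Prop := exists d,
  [/\ d \in corner true true, d \notin outer, tail (prev d) = u & head d = w].

Lemma right_neighbor_oo d : d \in corner true true -> d \notin outer ->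
  right_neighbor (head (rot d)) (head d).
Proof. by move=> dc dout; exists d; split; rewrite // rotE head_rev. Qed.

Lemma right_neighbor_ii d : d \in corner false false -> d \notin outer ->
  right_neighbor (head d) (head (rot d)).
Proof.
move=> dc dout; have [c1 o1] := ii_rhombus dc dout.
have [_ _ _ n3] := rhombus_corners c1 o1.
exists (prev (prev d)); split; rewrite // -?n3 ?permKV ?tail_next //.
by rewrite head_prev rotE head_rev.
Qed.

(** A vertex has at most one corner [false true], the one on its right, and this determines the
    rhombus there. The next lemma uses the corner [true false], on the left, in the same way. *)
Lemma right_neighbor_fun u w w' :
  right_neighbor u w -> right_neighbor u w' -> w = w'.
Proof.
case=> d [dc dout <- <-] [d' [d'c d'out dd' <-]].
have [c4 _ _ _] := rhombus_corners dc dout.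
have [c4' _ _ _] := rhombus_corners d'c d'out.
by rewrite (perm_inj (vertex_corner_inj c4 c4' (esym dd'))).
Qed.

Lemma right_neighbor_inj u u' w :
  right_neighbor u w -> right_neighbor u' w -> u = u'.
Proof.
case=> d [dc dout <- <-] [d' [d'c d'out <- dd']].
have [_ c2 _ _] := rhombus_corners dc dout.
have [_ c2' _ _] := rhombus_corners d'c d'out.
have /perm_inj -> // : next d = next d'.
by apply: vertex_corner_inj c2 c2' _; rewrite !tail_next.
Qed.

Lemma right_neighbor_left w : (exists u, right_neighbor u w) ->
  exists2 d, d \in corner true false & d \notin outer /\ tail d = w.
Proof.
case=> u [d [dc dout _ <-]]; have [_ c2 _ _] := rhombus_corners dc dout.
by exists (next d); rewrite ?outer_next ?tail_next.
Qed.

Lemma right_neighbor_right u : (exists w, right_neighbor u w) ->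
  exists2 d, d \in corner false true & tail d = u.
Proof.
case=> w [d [dc dout <- _]]; have [c4 _ _ _] := rhombus_corners dc dout.
by exists (prev d).
Qed.

Lemma inner_neq a d : d \in corner a (~~ a) -> tail d != s /\ tail d != t.
Proof.
move=> dc; split; apply/eqP => Dd.
  by have := source_corner Dd => /(corner_inj dc); case: a {dc} => -[].
by have := sink_corner Dd => /(corner_inj dc); case: a {dc} => -[].
Qed.

(** * Levels of vertices and bands of edges *)

(* [pos i j v]: [v] is the [j]-th vertex, from left to right, of level [i]. *)
Inductive pos : nat -> nat -> V -> Prop :=
| pos_source : pos 0 0 s
| pos_up i d : pos i 0 (tail d) -> d \in outer -> d.2 -> pos i.+1 0 (head d)
| pos_right i j u w : pos i j u -> right_neighbor u w -> pos i j.+1 w.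

(* [band i j k d]: [d] goes from the [j]-th vertex of level [i] to the [k]-th
   vertex of level [i.+1]. The constructors enumerate the edges between these
   two levels from left to right. *)
Inductive band : nat -> nat -> nat -> dart A -> Prop :=
| band_left i d : pos i 0 (tail d) -> d \in outer -> d.2 -> band i 0 0 d
| band_src i j k d : band i j k (rot d) -> d \in corner true true ->
    d \notin outer -> band i j k.+1 d
| band_tgt i j k d : band i j k (rev_dart d) -> d \in corner false false ->
    d \notin outer -> band i j.+1 k (rev_dart (rot d)).

Lemma band_pos i j k d : band i j k d ->
  [/\ d.2, pos i j (tail d) & pos i.+1 k (head d)].
Proof.
elim=> {i j k d} [i d pd dout d2|i j k d _ [d2 p1 p2] dc dout|i j k d _ [d2 p1
  p2] dc dout].
- by split=> //; apply: pos_up.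
- move: (dc); rewrite inE => /andP[/eqP -> _].
  rewrite tail_rot in p1; split=> //.
  exact: pos_right p2 (right_neighbor_oo dc dout).
move: (dc); rewrite inE => /andP[_ /eqP rd2]; split; first by rewrite /= rd2.
  exact: pos_right p1 (right_neighbor_ii dc dout).
by rewrite head_rev tail_rot -head_rev.
Qed.

(* Clockwise propagation around [v]; [base] covers the leftmost outgoing dart.
  *)
Lemma sweep_out i j v :
    (forall d, tail d = v -> d.2 -> d \in outer \/ d \in corner true false ->
      exists k, band i j k d) ->
  forall d, tail d = v -> d.2 -> exists k, band i j k d.
Proof.
move=> base; pose P (d : dart A) := d.2 -> exists k, band i j k d.
(* An incoming dart satisfies [P] vacuously; at [s], which has none, the sweep starts from a dart of
   the outer face. *)
have [x xv Px] : exists2 x, tail x = v & P x.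
  have [vs|vs] := eqVneq v s; last first.
    by have [x xv x2] := ex_in vs; exists x => //; rewrite /P (negPf x2).
  case: plane => _ _ _ _ [/outer_dart[x xo xs] _].
  by exists x; rewrite ?vs // => x2; apply: base => //; [rewrite vs | left].
have step d : tail d = v -> P (rot d) -> P d.
  move=> dv Pr d2; have [r2|r2] := boolP (rot d).2; last first.
    by apply: base => //; right; rewrite inE d2 (negPf r2).
  have [dout|dout] := boolP (d \in outer); first by apply: base => //; left.
  have [k bk] := Pr r2; exists k.+1; apply: band_src => //.
  by rewrite inE d2 r2.
move=> d dv; have : d \in porbit rot x by rewrite mem_porbit_rot dv xv.
rewrite porbit_sym => /porbitP[n]; elim: n d dv => [|n IH] d dv.
  by rewrite expg0 perm1 => xd; rewrite -xd; apply: Px.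
by rewrite expgS permM => /IH Pr; apply: step => //; apply: Pr;
  rewrite tail_rot.
Qed.

(* Counterclockwise propagation around [v], from the leftmost incoming dart. *)
Lemma sweep_in i k v :
    (forall d, tail d = v -> ~~ (rot d).2 ->
       d \in outer \/ d \in corner true false ->
     exists j, band i j k (prev d)) ->
  forall d, tail d = v -> ~~ d.2 -> exists j, band i j k (rev_dart d).
Proof.
move=> base; pose P (d : dart A) := ~~ d.2 -> exists j, band i j k (rev_dart d).
have base' d : tail d = v -> d \in outer \/ d \in corner true false ->
  P (rot d).
  by move=> dv d0 r2; rewrite rotE rev_dartK; apply: base.
have [x xv Px] : exists2 x, tail x = v & P x.
  have [vt|vt] := eqVneq v t; last first.
    by have [x xv x2] := ex_out vt; exists x => //; rewrite /P x2.
  case: plane => _ _ _ _ [_ /outer_dart[x xo xt]].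
  exists (rot x); first by rewrite tail_rot xt.
  by apply: base'; [rewrite vt | left].
have step d : tail d = v -> P d -> P (rot d).
  move=> dv Pr; have [dout|dout] := boolP (d \in outer).
    by apply: base' => //; left.
  have [d2|d2] := boolP d.2 => r2.
    by apply: base' => //; right; rewrite inE d2 (negPf r2).
  have [j bj] := Pr d2; exists j.+1; apply: band_tgt => //.
  by rewrite inE (negPf d2) (negPf r2).
move=> d dv; have : d \in porbit rot x by rewrite mem_porbit_rot dv xv.
move/porbitP => [n ->]; elim: n => [|n IH]; first by rewrite expg0 perm1.
rewrite expgSr permM; apply: step => //.
by apply/eqP; rewrite -xv -mem_porbit_rot mem_porbit.
Qed.

(** Otherwise [head d] would carry the corner [false false] of the outer face, which is at [t]. *)
Lemma outer_left_corner d : d \in outer -> d.2 -> head d != t ->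
  next d \in corner true false.
Proof.
move=> dout d2 dt; rewrite cornerE permK d2 andbT.
apply: contraNeq dt => n2.
have nc : next d \in corner false false.
  by rewrite cornerE permK d2; move: n2; case: (next d).2.
by rewrite -tail_next (outer_corner nc) ?outer_next.
Qed.

Lemma outer_left_out d : d \in outer -> d.2 -> tail d != s ->
  d \in corner true false.
Proof.
move=> dout d2 ds; rewrite inE d2 /=; apply: contraNeq ds => r2.
have dc : d \in corner true true by rewrite inE d2; move: r2; case: (rot d).2.
by rewrite (outer_corner dc dout).
Qed.

(** The leftmost outgoing dart, needed by [sweep_out], is either on the left boundary of the graph
    or the upper right edge of a rhombus. In the latter case the upper left edge leaves the left
    neighbour, where the induction hypothesis applies. *)
Lemma pos_out i j v : pos i j v ->
  forall d, tail d = v -> d.2 -> exists k, band i j k d.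
Proof.
elim=> {i j v} [|i d0 pd0 _ d0out d02|i j u w pu IH uw];
  apply: sweep_out => d dv d2.
- case=> dc; first by exists 0; apply: band_left; rewrite ?dv //; constructor.
  by have [] := inner_neq (a := true) dc; rewrite dv eqxx.
- have p1 : pos i.+1 0 (tail d) by rewrite dv; apply: pos_up.
  have dt : tail d != t by apply: contraL d2 => /eqP; apply: sink_dart.
  case=> dc; first by exists 0; apply: band_left.
  have c0 : next d0 \in corner true false by apply: outer_left_corner;
    rewrite -?dv.
  exists 0; apply: band_left => //.
  by rewrite (@vertex_corner_inj true d _ dc c0) ?outer_next // tail_next.
- have [c cc [cout cw]] := right_neighbor_left (ex_intro _ u uw).
  have ws : w != s by rewrite -cw; have [] := inner_neq (a := true) cc.
  have {}dc : d \in outer \/ d \in corner true false -> d = c.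
    move=> dc; apply: (@vertex_corner_inj true) => //; last by rewrite cw.
    by case: dc => // dout; apply: outer_left_out; rewrite ?dv.
  move/dc => ->; have [c1 o1] := oi_rhombus cc cout.
  have [c4 _ c3 n3] := rhombus_corners c1 o1; rewrite permKV in c3 n3.
  have o3 : next c \notin outer by rewrite outer_next.
  have uE : u = head (next c).
    apply: (right_neighbor_inj uw); have := right_neighbor_ii c3 o3.
    by rewrite rotE permK head_rev cw.
  have [|k bk] := IH (rev_dart (next c)) (esym uE).
    by move: c3; rewrite inE => /andP[/eqP /= ->].
  exists k; have := band_tgt bk c3 o3.
  by rewrite rotE permK rev_dartK.
Qed.

(** The leftmost incoming edge is either on the left boundary or the lower right edge of a rhombus,
    whose lower left edge enters the left neighbour. *)
Lemma pos_in i k v : pos i.+1 k v ->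
  forall d, tail d = v -> ~~ d.2 -> exists j, band i j k (rev_dart d).
Proof.
move Di : i.+1 => i' pv; elim: pv i Di =>
  {i' k v} [|i' d0 pd0 _ d0out d02|i' k u w pu IH uw] // i [] Di.
  rewrite {}Di; apply: sweep_in => d dv r2 dc; exists 0.
  suff <- : next d0 = d by rewrite permK; apply: band_left.
  have [vt|vt] := eqVneq (head d0) t.
    have d_ii : d \in corner false false by apply: sink_corner; rewrite dv.
    apply: (@outer_corner_inj false) => //; rewrite ?outer_next //.
      by apply: sink_corner; rewrite tail_next.
    by case: dc => // dc; have [] := corner_inj dc d_ii.
  have c0 : next d0 \in corner true false by apply: outer_left_corner.
  apply: (@vertex_corner_inj true) => //; last by rewrite tail_next dv.
  case: dc => // dout; have [d2|d2] := boolP d.2;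
    first by rewrite inE d2 (negPf r2).
  case/eqP: vt; rewrite -dv; apply: (outer_corner (b := false)) => //.
  by rewrite inE (negPf d2) (negPf r2).
have [c cc [cout cw]] := right_neighbor_left (ex_intro _ u uw).
have [ws wt] := inner_neq (a := true) cc; rewrite cw in ws wt.
apply: sweep_in => d dw r2 dc.
have -> : d = c.
  apply: (@vertex_corner_inj true) => //; last by rewrite cw.
  case: dc => // dout; have [d2|d2] := boolP d.2;
    first by rewrite inE d2 (negPf r2).
  case/eqP: wt; rewrite -dw; apply: (outer_corner (b := false)) => //.
  by rewrite inE (negPf d2) (negPf r2).
have [c1 o1] := oi_rhombus cc cout.
have uE : u = head (rot (prev c)).
  apply: (right_neighbor_inj uw); have := right_neighbor_oo c1 o1.
  by rewrite head_prev cw.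
have [||j bj] := IH i _ (rev_dart (rot (prev c))) (esym uE);
  first by rewrite Di.
  by move: c1; rewrite inE => /andP[_ /eqP /= ->].
by exists j; apply: (band_src _ c1 o1); rewrite rev_dartK in bj.
Qed.

Lemma pos_rank0 j v : pos 0 j v -> j = 0 /\ v = s.
Proof.
move Di : 0 => i pv; elim: pv Di => {i j v} // i j u w _ IH uw i0.
have [_ us] := IH i0; have [c cc cu] := right_neighbor_right (ex_intro _ w uw).
by have [] := inner_neq (a := false) cc; rewrite cu us eqxx.
Qed.

Lemma pos_rankS i j v : pos i.+1 j v -> v != s.
Proof.
move Di : i.+1 => i' pv; elim: pv Di =>
  {i' j v} // [i' d _ _ _ d2 _|i' j u w _ _ uw _].
  by apply/eqP => /(@source_dart (rev_dart d)); rewrite /= d2.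
have [c cc [_ <-]] := right_neighbor_left (ex_intro _ u uw).
by have [] := inner_neq (a := true) cc.
Qed.

(** The unique corner [true false] of a right neighbour is in an internal face, whereas that of
    [head d] is in the outer face. *)
Lemma outer_left_right_neighbor d u : d \in outer -> d.2 ->
  ~ right_neighbor u (head d).
Proof.
move=> dout d2 ud; have [c cc [cout cd]] := right_neighbor_left (ex_intro _ u
  ud).
have [_] := inner_neq (a := true) cc; rewrite cd => dt.
have nc := outer_left_corner dout d2 dt.
have ncd : next d = c by apply: (@vertex_corner_inj true);
  rewrite // tail_next cd.
by rewrite -ncd outer_next dout in cout.
Qed.

Lemma pos_fun i j v v' : pos i j v -> pos i j v' -> v = v'.
Proof.
move=> pv; elim: pv v' => {i j v} [|i d pd IH dout d2|i j u w pu IH uw] v' pv'.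
- by have [_ ->] := pos_rank0 pv'.
- inversion pv' as [|i' d' pd' d'out d'2|]; subst.
  by rewrite (outer_out_inj dout d'out d2 d'2 (IH _ pd')).
- inversion pv' as [| |i' j' u' w' pu' uw']; subst.
  by apply: (right_neighbor_fun uw); rewrite (IH _ pu').
Qed.

(** Incoming edges come from the previous level, so the level is unique by induction. Inside a
    level, the position counts the moves to a left neighbour until the left boundary, where no
    further move is possible. *)
Lemma pos_inj i j i' j' v : pos i j v -> pos i' j' v -> i = i' /\ j = j'.
Proof.
move=> pv pv'; have Di : i = i'.
  elim: i i' j j' v pv pv' => [|i IH] [|i'] j j' v pv pv' //.
  - by have := pos_rankS pv'; have [_ ->] := pos_rank0 pv; rewrite eqxx.
  - by have := pos_rankS pv; have [_ ->] := pos_rank0 pv'; rewrite eqxx.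
  have [d dv d2] := ex_in (pos_rankS pv).
  have [j1 /band_pos[_ p1 _]] := pos_in pv dv d2.
  have [j2 /band_pos[_ p2 _]] := pos_in pv' dv d2.
  by rewrite (IH _ _ _ _ p1 p2).
split=> //; rewrite -{i'}Di in pv'.
elim: pv j' pv' => {i j v} [|i d pd IH dout d2|i j u w pu IH uw] j' pv'.
- by have [->] := pos_rank0 pv'.
- inversion pv' as [| |i' k u' w' pu' uw']; subst => //.
  by have := outer_left_right_neighbor dout d2 uw'.
- inversion pv' as [|i' d pd dout d2|i' k u' w' pu' uw']; subst.
  + by have := right_neighbor_left (ex_intro _ u uw) =>
    -[c /(inner_neq (a := true))[cs _] [_ cw]]; rewrite cw eqxx in cs.
  + by have := outer_left_right_neighbor dout d2 uw.
  + by rewrite (IH k) // (right_neighbor_inj uw uw').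
Qed.

Lemma pos_total v : exists i, exists j, pos i j v.
Proof.
move: v; apply: (acyclic_ind st_acyclic) => v IH.
have [->|vs] := eqVneq v s; first by exists 0, 0; constructor.
have [d dv d2] := ex_in vs.
have := dart_edge d; rewrite (negPf d2) dv => /IH[i [j pd]].
have [|k /band_pos[_ _ pv]] := pos_out (d := rev_dart d) pd erefl;
  first by rewrite /= d2.
by exists i.+1, k; rewrite -dv -head_rev.
Qed.

(** The sum [j + k] numbers the edges of a band, as each step raises it by one. The constructors
    [band_src] and [band_tgt] cannot both extend the same edge: its reverse would be a corner
    [false true] and a corner [false false]. *)
Lemma band_fun i j k j' k' d d' : band i j k d -> band i j' k' d' ->
  j + k = j' + k' -> [/\ d = d', j = j' & k = k'].
Proof.
move=> bd; elim: bd j' k' d' =>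
  {i j k d} [i d pd dout d2|i j k d bd IH dc dout|i j k d bd IH dc dout] j' k'
    d' bd' e.
- inversion bd' as [i' x px xout x2| |]; subst; try by lia.
  by rewrite (outer_out_inj dout xout d2 x2 (pos_fun pd px)).
- inversion bd' as [|i' j1 k1 x bx xc xout|i' j1 k1 x bx xc xout]; subst;
  try by lia.
  + by have [|/perm_inj -> -> ->] := IH _ _ _ bx; first by lia.
  + have [|Dx] := IH _ _ _ bx; first by lia.
    have [c4 _ _ _] := rhombus_corners dc dout; rewrite rotE in Dx.
    by have := corner_inj c4; rewrite (rev_dart_inj Dx) => /(_ _ _ xc)[].
- inversion bd' as [|i' j1 k1 x bx xc xout|i' j1 k1 x bx xc xout]; subst;
  try by lia.
  + have [|Dx] := IH _ _ _ bx; first by lia.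
    have [c4 _ _ _] := rhombus_corners xc xout; rewrite rotE in Dx.
    by have := corner_inj c4; rewrite -(rev_dart_inj Dx) => /(_ _ _ dc)[].
  + by have [|/rev_dart_inj -> -> ->] := IH _ _ _ bx; first by lia.
Qed.

(** The enumeration raises one index by one at each step and never lowers the other, so it passes
    through every smaller sum. *)
Lemma band_below i j k d m : band i j k d -> m <= j + k ->
  exists j' k' d', [/\ band i j' k' d', j' + k' = m, j' <= j & k' <= k].
Proof.
elim=> {i j k d} [i d pd dout d2|i j k d bd IH dc dout|i j k d bd IH dc dout]
  le.
- by exists 0, 0, d; split=> //; [apply: band_left | lia].
- have [/IH[j' [k' [d' [b' e lj lk]]]]|gt] := leqP m (j + k).
    by exists j', k', d'; split=> //; lia.
  by exists j, k.+1, d; split=> //; [apply: band_src | lia].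
- have [/IH[j' [k' [d' [b' e lj lk]]]]|gt] := leqP m (j + k).
    by exists j', k', d'; split=> //; lia.
  by exists j.+1, k, (rev_dart (rot d)); split=> //; [apply: band_tgt | lia].
Qed.

(** The edge with the smaller number is met on the way to the other one, so neither of its indices
    is larger. *)
Lemma band_mono i j k d j' k' d' :
  band i j k d -> band i j' k' d' -> j < j' -> k <= k'.
Proof.
move=> bd bd' jj'; have [le|/ltnW le] := leqP (j + k) (j' + k').
  have [j1 [k1 [d1 [b1 e lj lk]]]] := band_below bd' le.
  by have [_ _ ->] := band_fun bd b1 (esym e).
have [j1 [k1 [d1 [b1 e lj lk]]]] := band_below bd le.
have [_ Dj _] := band_fun bd' b1 (esym e); lia.
Qed.

(** The last two properties serve the drawing: around a vertex the order [ccw_step] wraps around at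
    most once, and some edge from the bottom vertex to the leftmost vertex of level 1 borders the
    outer face. *)
Lemma nontrivial_leveling : exists rk x : V -> nat,
  [/\ forall e : edge A, rk (tgt e) = (rk (src e)).+1,
      forall u v, rk u = rk v -> x u = x v -> u = v,
      forall e e' : edge A, rk (src e) = rk (src e') ->
        x (src e) < x (src e') -> x (tgt e) <= x (tgt e'),
      forall d d', tail d = tail d' -> ~~ ccw_step x d (rot d) ->
        ~~ ccw_step x d' (rot d') -> d = d'
    & exists e : edge A, [/\ (e, true) \in outer, rk (src e) = 0,
        x (tgt e) = 0 & forall v, rk v = 0 -> v = src e]].
Proof.
have /fin_all_exists[rk /fin_all_exists[x pos_rx]] := pos_total.
have rx i j v : pos i j v -> rk v = i /\ x v = j.
  by move=> pv; have [-> ->] := pos_inj (pos_rx v) pv.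
have out_band (d : dart A) : d.2 -> exists k,
  band (rk (tail d)) (x (tail d)) k d.
  exact: pos_out (pos_rx _) _ erefl.
have right_x u w : right_neighbor u w -> x w = (x u).+1.
  by move=> uw; have [_] := rx _ _ _ (pos_right (pos_rx u) uw).
have step_oo d : d \in corner true true -> d \notin outer ->
  ccw_step x d (rot d).
  move=> dc dout; have := right_x _ _ (right_neighbor_oo dc dout).
  by move: (dc); rewrite inE /ccw_step => /andP[/eqP -> /eqP ->] ->.
have step_ii d : d \in corner false false -> d \notin outer ->
  ccw_step x d (rot d).
  move=> dc dout; have := right_x _ _ (right_neighbor_ii dc dout).
  by move: (dc); rewrite inE /ccw_step => /andP[/eqP -> /eqP ->] ->.
exists rk, x; split.
- move=> e; have [k /band_pos[_ _ pt]] := out_band (e, true) erefl.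
  by have [->] := rx _ _ _ pt.
- move=> u v ruv xuv; apply: pos_fun (pos_rx u) _.
  by rewrite ruv xuv.
- move=> e e' re lt; have [k b] := out_band (e, true) erefl.
  have [k' b'] := out_band (e', true) erefl.
  have [_ _ pt] := band_pos b; have [_ _ pt'] := band_pos b'.
  have [_ ->] := rx _ _ _ pt; have [_ ->] := rx _ _ _ pt'.
  by move: b' lt; rewrite /tail /= -re => b' lt; apply: band_mono b b' lt.
(* The order can only wrap around on the right of a vertex, or in the outer face at [s] or [t]. *)
- have kind d : ~~ ccw_step x d (rot d) ->
      [\/ tail d = s /\ d \in outer,
        tail d = t /\ d \in outer | d \in corner false true].
    case d2: d.2; case r2: (rot d).2 => ns; last 1 first.
    - have dc : d \in corner false false by rewrite inE d2 r2.
      have [dout|dout] := boolP (d \in outer); last by rewrite step_ii in ns.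
      by constructor 2; rewrite (outer_corner dc dout).
    - have dc : d \in corner true true by rewrite inE d2 r2.
      have [dout|dout] := boolP (d \in outer); last by rewrite step_oo in ns.
      by constructor 1; rewrite (outer_corner dc dout).
    - by rewrite /ccw_step d2 r2 in ns.
    by constructor 3; rewrite inE d2 r2.
  move=> d d' dd' /kind kd /kind kd'.
  have [ds|ds] := eqVneq (tail d) s.
    have dc := source_corner ds;
      have d'c := source_corner (etrans (esym dd') ds).
    apply: (outer_corner_inj dc) => //.
      by case: kd => [[]|[]|/(corner_inj dc)[]].
    by case: kd' => [[]|[]|/(corner_inj d'c)[]].
  have [dt|dt] := eqVneq (tail d) t.
    have dc := sink_corner dt; have d'c := sink_corner (etrans (esym dd') dt).
    apply: (outer_corner_inj dc) => //.
      by case: kd => [[]|[]|/(corner_inj dc)[]].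
    by case: kd' => [[]|[]|/(corner_inj d'c)[]].
  apply: (@vertex_corner_inj false) => //.
    by case: kd => // -[dv]; rewrite dv eqxx in ds dt.
  by case: kd' => // -[dv]; rewrite dd' dv eqxx in ds dt.
- case: plane => _ _ _ _ [/outer_dart[d dout ds] _].
  have d2 := source_dart ds; have De : (d.1,
    true) = d by case: d d2 {dout ds} => e [].
  have sd : src d.1 = s by rewrite -ds -De.
  exists d.1; rewrite De sd; have [-> _] := rx _ _ _ pos_source; split=> //.
    have pd : pos 0 0 (tail d) by rewrite ds; constructor.
    by have [_] := rx _ _ _ (pos_up pd dout d2); rewrite -De.
  by move=> v rv; have := pos_rx v; rewrite rv => /pos_rank0[].
Qed.

End Nontrivial.

(** A graph without darts is a single vertex with an empty outer face, and constant functions do. *)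
Lemma leveling :
  (forall f, f \in faces rot -> f <> outer -> rhombus rot f) ->
  exists rk x : V -> nat,
  [/\ forall e : edge A, rk (tgt e) = (rk (src e)).+1,
      forall u v, rk u = rk v -> x u = x v -> u = v,
      forall e e' : edge A, rk (src e) = rk (src e') ->
        x (src e) < x (src e') -> x (tgt e) <= x (tgt e'),
      forall d d', tail d = tail d' -> ~~ ccw_step x d (rot d) ->
        ~~ ccw_step x d' (rot d') -> d = d'
    & outer = set0 \/ exists e : edge A, [/\ (e, true) \in outer,
      rk (src e) = 0,
        x (tgt e) = 0 & forall v, rk v = 0 -> v = src e]].
Proof.
move=> rh; have [d|no_dart] := pickP {: dart A}.
  move=> _; have [rk [x [? ? ? ? ?]]] := nontrivial_leveling d rh.
  by exists rk, x; split=> //; right.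
have no_edge (e : edge A) : False by have := no_dart (e, true); rewrite inE.
exists (fun=> 0), (fun=> 0); split=> //.
- have single v : v = s.
    case: plane => [[_ /(_ v) + _]] _ _ _ _;
      case: eqP => // _ /forallPn[u /negPn Auv].
    by have := no_edge (exist _ (u, v) Auv).
  by move=> u v _ _; rewrite (single u) (single v).
- by move=> d; have := no_dart d; rewrite inE.
left; case: plane => _ _ _ + _; rewrite /faces.
by rewrite (eq_card0 no_dart) eqxx inE => /eqP.
Qed.

End PlaneGraph.

(** * The order of the vertices along the spine *)

(** The orbit is cut into three arcs, from [a] to [p a], from [p a] to [c] and from [c] to [a]. At
    most one contains a step violating [S]; along the other two, transitivity applies. *)
Lemma perm_cyclic_order (T : finType) (p : {perm T}) (S : rel T) (a c : T) :
    transitive S ->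
    {in porbit p a &, forall y z, ~~ S y (p y) -> ~~ S z (p z) -> y = z} ->
    c \in porbit p a -> c <> a -> c <> p a ->
  [\/ S a (p a) && S (p a) c, S (p a) c && S c a | S c a && S a (p a)].
Proof.
move=> trS bad cp ca cpa; pose z i := iter i p a; set m := #|porbit p a|.
have zin i : z i \in porbit p a by rewrite /z -permX mem_porbit.
have zinj i j : i < m -> j < m -> z i = z j -> i = j.
  move=> im jm; rewrite /z -(nth_traject p im a) -(nth_traject p jm a) => /eqP.
  by rewrite nth_uniq ?size_traject ?uniq_traject_porbit // => /eqP.
have seg i j : i < j ->
    S (z i) (z j) \/ exists2 l, i <= l < j & ~~ S (z l) (z l.+1).
  elim: j => // j IH; rewrite ltnS leq_eqVlt => /predU1P[->|ij].
    by have [|nS] := boolP (S (z j) (z j.+1)); [left | right; exists j;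
      rewrite ?leqnn].
  have [Sij|[l /andP[il lj] nS]] := IH ij; last first.
    by right; exists l; rewrite // il ltnW.
  have [Sj|nS] := boolP (S (z j) (z j.+1)); first by left; apply: trS Sij Sj.
  by right; exists j; rewrite // ltnW //=.
have one l l' : l < m -> l' < m -> ~~ S (z l) (z l.+1) ->
  ~~ S (z l') (z l'.+1) -> l = l'.
  by move=> lm l'm /= nS nS'; apply: zinj => //; apply: bad; rewrite ?zin.
have [n nm cE] : exists2 n, n < m & c = z n.
  by move: cp; rewrite porbit_traject => /trajectP[n nm ->]; exists n.
have n1 : 1 < n.
  by case: n cE {nm} => [|[|n]] cE.
have zm : z m = a by apply: iter_porbit.
have [S01|[l /andP[_ l1] nS]] := seg 0 1 isT;
have := seg 1 n n1; have := seg n m nm; rewrite zm -cE;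
move=> [Snm|[k /andP[nk km] nSk]] [S1n|[l' /andP[l'1 l'n] nS']].
- by constructor 1; apply/andP.
- by constructor 3; apply/andP.
- by constructor 1; apply/andP.
- by have := one _ _ (ltn_trans l'n nm) km nS' nSk; lia.
- by constructor 2; apply/andP.
- by have := one _ _ (ltn_trans l1 (ltn_trans n1 nm)) (ltn_trans l'n nm) nS nS';
  lia.
- by have := one _ _ (ltn_trans l1 (ltn_trans n1 nm)) km nS nSk; lia.
- by have := one _ _ (ltn_trans l1 (ltn_trans n1 nm)) km nS nSk; lia.
Qed.

Lemma rank_by_key (V : finType) (K : V -> nat) : injective K ->
  exists pi : V -> 'I_#|V|, bijective pi /\ forall u v,
    (pi u < pi v) = (K u < K v).
Proof.
move=> Kinj; pose below v := [set u | K u < K v].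
have lt v : #|below v| < #|V|.
  by rewrite -cardsT; apply/proper_card/properP; split;
    [apply/subsetP | exists v; rewrite ?inE ?ltnn].
pose pi v := Ordinal (lt v).
have mono u v : K u < K v -> pi u < pi v.
  move=> uv; apply/proper_card/properP; split.
    by apply/subsetP => w; rewrite !inE => /ltn_trans; apply.
  by exists u; rewrite !inE ?ltnn.
have pi_lt u v : (pi u < pi v) = (K u < K v).
  apply/idP/idP => [|/mono //]; apply: contraTT; rewrite -!leqNgt leq_eqVlt.
  by case/predU1P => [/Kinj->|/mono /ltnW].
exists pi; split=> //; apply: inj_card_bij; last by rewrite card_ord.
move=> u v uv; apply: Kinj; have := pi_lt u v; have := pi_lt v u.
by rewrite uv ltnn; case: ltngtP.
Qed.

Section LevelOrder.
Variables (V : finType) (A : rel V) (rk x : V -> nat).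
Hypothesis rk_edge : forall e : edge A, rk (tgt e) = (rk (src e)).+1.
Hypothesis rk_x_inj : forall u v, rk u = rk v -> x u = x v -> u = v.
Hypothesis edge_mono : forall e e' : edge A, rk (src e) = rk (src e') ->
  x (src e) < x (src e') -> x (tgt e) <= x (tgt e').

(* Levels are visited bottom up, even ones from left to right and odd ones
   from right to left. *)
Definition before (u v : V) : bool :=
  (rk u < rk v) || (rk u == rk v) && (if odd (rk u) then x v < x u else x u < x
    v).

(** The lexicographic order in base [m.+1]: the level is the leading digit, and odd levels are read
    from the right. *)
Definition key (v : V) : nat :=
  let m := \max_u x u in rk v * m.+1 + (if odd (rk v) then m - x v else x v).

Lemma key_lt u v : (key u < key v) = before u v.
Proof.
rewrite /key /before; set m := \max_u x u.
have xu : x u <= m by apply: leq_bigmax.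
have xv : x v <= m by apply: leq_bigmax.
have [ruv|rvu|->] := ltngtP (rk u) (rk v) => /=.
- have : (rk u).+1 * m.+1 <= rk v * m.+1 by rewrite leq_mul2r ruv orbT.
  by case: odd; case: odd; lia.
- have : (rk v).+1 * m.+1 <= rk u * m.+1 by rewrite leq_mul2r rvu orbT.
  by case: odd; case: odd; lia.
- by rewrite ltn_add2l; case: odd => //; lia.
Qed.

Lemma key_inj : injective key.
Proof.
move=> u v uv; have := key_lt u v; have := key_lt v u; rewrite uv ltnn /before.
case: ltngtP => //= ruv; rewrite ruv => l1 l2; apply: rk_x_inj => //.
by move: l1 l2; case: odd; lia.
Qed.

Definition level_page (e : edge A) := if odd (rk (src e)) then Rpage else Lpage.

Lemma before_le u v : before u v -> rk u <= rk v.
Proof. by case/orP => [/ltnW|/andP[/eqP->]]. Qed.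

(** The sources of two crossing edges would be at most one level apart and of equal parity, hence on
    one level. Consecutive levels are traversed in opposite directions, so [edge_mono] rules out a
    crossing. *)
Lemma level_2UBE (pi : V -> 'I_#|V|) : bijective pi ->
  (forall u v, (pi u < pi v) = before u v) -> is_2UBE pi level_page.
Proof.
move=> pi_bij piE; split=> // [u v Auv|e e' pg].
  have /= ruv := rk_edge (exist (fun e => A e.1 e.2) (u, v) Auv).
  by rewrite piE /before [rk v]ruv leqnn.
rewrite !piE => -[b1 b2 b3]; have := before_le b1; have := before_le b2.
have par : odd (rk (src e)) = odd (rk (src e')).
  by move: pg; rewrite /level_page; case: odd; case: odd.
rewrite rk_edge leq_eqVlt => /predU1P[re|]; first by move: par; rewrite re /=;
  case: odd.
rewrite ltnS => le1 le2; have re : rk (src e) = rk (src e') by apply/eqP;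
  rewrite eqn_leq le1 le2.
move: b1 b3; rewrite /before !rk_edge re !ltnn !eqxx /=.
case: odd => /= l1 l2.
  by have := edge_mono (esym re) l1; rewrite leqNgt l2.
by have := edge_mono re l1; rewrite leqNgt l2.
Qed.

Lemma ccw_step_trans : transitive (@ccw_step V A x).
Proof. by rewrite /ccw_step => d2 d1 d3; case: d1.2; case: d2.2;
  case: d3.2 => //; lia. Qed.

End LevelOrder.

(** * The canonical drawing *)

From mathcomp Require Import ring lra.
From mathcomp Require Import classical_sets prodnormedzmodule topology
  normedtype.
Import Order.TTheory GRing.Theory Num.Theory.
Import numFieldNormedType.Exports.

Local Open Scope ring_scope.

(** * Orientation of three points of a circle *)

Definition quadrant (R : numDomainType) (b : bool) (u w : R) : Prop :=
  if b then 0 < u /\ 0 < w else u < 0 /\ w < 0.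

(** Counterclockwise order from the positive quadrant, meant for outgoing darts, to the opposite
    one, meant for incoming darts. *)
Definition quadrant_lt (R : numDomainType) (b : bool) (w : R) (b' : bool) (w' :
  R) : bool :=
  match b, b' with
  | true, true => w < w'
  | false, false => w' < w
  | b, _ => b
  end.

Lemma ccw_rot (R : realType) (p q r : R * R) : ccw p q r -> ccw q r p.
Proof. by rewrite /ccw; congr (_ < _); ring. Qed.

(** The circle equations give [(u1 - u2) * (u1 + u2) = (w2 - w1) * (w2 + w1)], and likewise for
    [u3]. Multiplied by [(u1 + u2) * (u1 + u3)], the determinant thus becomes a product of positive
    factors. *)
Lemma quarter_ccw (R : realType) (E u1 w1 u2 w2 u3 w3 : R) :
    u1 ^+ 2 + w1 ^+ 2 = E -> u2 ^+ 2 + w2 ^+ 2 = E -> u3 ^+ 2 + w3 ^+ 2 = E ->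
    0 < u1 -> 0 < w1 -> 0 < u2 -> 0 < u3 -> w1 < w2 -> w2 < w3 ->
  0 < (u2 - u1) * (w3 - w1) - (w2 - w1) * (u3 - u1).
Proof.
move=> e1 e2 e3 pu1 pw1 pu2 pu3 w12 w23.
have u13 : u3 < u1 by nra.
have u23 : u3 < u2 by nra.
have u12 : u2 < u1 by nra.
have f2 : (u1 - u2) * (u1 + u2) = (w2 - w1) * (w2 + w1) by lra.
have f3 : (u1 - u3) * (u1 + u3) = (w3 - w1) * (w3 + w1) by lra.
have pos : 0 < (u1 + u2) * (u1 + u3) by rewrite mulr_gt0 // addr_gt0.
rewrite -(pmulr_rgt0 _ pos).
have -> : (u1 + u2) * (u1 +
  u3) * ((u2 - u1) * (w3 - w1) - (w2 - w1) * (u3 - u1)) =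
  (w2 - w1) * (w3 - w1) * ((w3 + w1) * (u1 + u2) - (w2 + w1) * (u1 + u3)).
  have -> : (u1 + u2) * (u1 +
    u3) * ((u2 - u1) * (w3 - w1) - (w2 - w1) * (u3 - u1)) =
    (w2 - w1) * (u1 + u2) * ((u1 - u3) * (u1 + u3)) - (u1 +
      u3) * (w3 - w1) * ((u1 - u2) * (u1 + u2)) by ring.
  rewrite f2 f3; ring.
apply: mulr_gt0; first by apply: mulr_gt0; lra.
nra.
Qed.

(** Points in a single quadrant reduce to [quarter_ccw], up to a half-turn; otherwise the
    determinant is a sum of two positive products. *)
Lemma quadrant_ccw (R : realType) (E : R) b1 b2 b3 (u1 w1 u2 w2 u3 w3 : R) :
    u1 ^+ 2 + w1 ^+ 2 = E -> u2 ^+ 2 + w2 ^+ 2 = E -> u3 ^+ 2 + w3 ^+ 2 = E ->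
    quadrant b1 u1 w1 -> quadrant b2 u2 w2 -> quadrant b3 u3 w3 ->
    quadrant_lt b1 w1 b2 w2 -> quadrant_lt b2 w2 b3 w3 ->
  0 < (u2 - u1) * (w3 - w1) - (w2 - w1) * (u3 - u1).
Proof.
case: b1; case: b2; case: b3 =>
  //= e1 e2 e3 [pu1 pw1] [pu2 pw2] [pu3 pw3] lt1 lt2.
- exact: (@quarter_ccw R E).
- have u12 : u2 < u1 by nra.
  have : 0 < (u1 - u2) * (w1 - w3) by apply: mulr_gt0; lra.
  have : 0 < (w2 - w1) * (u1 - u3) by apply: mulr_gt0; lra.
  lra.
- have u23 : u2 < u3 by nra.
  have : 0 < (u3 - u2) * (w1 - w2) by apply: mulr_gt0; lra.
  have : 0 < (w2 - w3) * (u1 - u2) by apply: mulr_gt0; lra.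
  lra.
- have := @quarter_ccw R E (- u1) (- w1) (- u2) (- w2) (- u3) (- w3).
  rewrite !sqrrN !oppr_gt0 !ltrN2 => /(_ e1 e2 e3 pu1 pw1 pu2 pu3 lt1 lt2).
  by congr (_ < _); ring.
Qed.

Lemma inv_lt (R : realFieldType) (E a b a' b' : R) : 0 < E ->
  a * b = E -> a' * b' = E -> 0 < a * a' -> a < a' -> b' < b.
Proof.
move=> E0 ab ab' aa' lt.
have e : (a * a') * (b - b') = E * (a' - a).
  have -> : (a * a') * (b - b') = a' * (a * b) - a * (a' * b') by ring.
  rewrite ab ab'; ring.
by rewrite -subr_gt0 -(pmulr_rgt0 _ aa') e mulr_gt0 // subr_gt0.
Qed.

(** * Order of the arcs around a vertex *)

Section Drawing.
Variables (R : realType) (V : finType) (A : rel V) (rk x : V -> nat).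
Variable (pi : V -> 'I_#|V|).
Hypothesis rk_edge : forall e : edge A, rk (tgt e) = (rk (src e)).+1%N.
Hypothesis pi_lt : forall u v, (pi u < pi v)%N = before rk x u v.

Local Notation sigma := (@level_page V A rk).
Local Notation height := (@height R V pi).

Lemma lt_height u v : (height u < height v) = before rk x u v.
Proof. by rewrite ltr_nat ltnS pi_lt. Qed.

Lemma height_gap u v : before rk x u v -> height u + 1 <= height v.
Proof. by rewrite -pi_lt /height natr1 ler_nat ltnS. Qed.

Lemma edge_before (e : edge A) : before rk x (src e) (tgt e).
Proof. by rewrite /before rk_edge ltnSn. Qed.

(** The endpoints of the edge span a diameter of the circle, whence the product form of its
    equation. *)
Lemma edge_arcE (e : edge A) (p : R * R) : edge_arc pi sigma e p <->
  p.1 ^+ 2 + (p.2 - height (src e)) * (p.2 - height (tgt e)) = 0 /\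
  (if odd (rk (src e)) then 0 <= p.1 else p.1 <= 0).
Proof.
rewrite /edge_arc /= /sqdist /arc_center /arc_radius /=.
rewrite /level_page; case: odd; split=> -[eqn side]; split=> //; lra.
Qed.

(* The coordinates at [v], turned by a right angle on even levels: there, the
   outgoing arcs leave to the left and the incoming ones arrive from the right,
   and conversely on odd levels. *)
Definition ucoord v (p : R * R) := if odd (rk v) then p.1 else p.2 - height v.
Definition wcoord v (p : R * R) := if odd (rk v) then p.2 - height v else - p.1.

Lemma dart_gap (d : dart A) : if d.2 then 1 <= height (head d) - height (tail d)
  else height (head d) - height (tail d) <= -1.
Proof.
by case: d => e [] /=; have := height_gap (edge_before e);
  rewrite /head /tail /=; lra.
Qed.

Lemma dart_page (d : dart A) : odd (rk (src d.1)) = (odd (rk (tail d)) == d.2).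
Proof. by case: d => e []; rewrite /tail /= ?rk_edge /=; case: odd. Qed.

Lemma rk_head (d : dart A) :
  if d.2 then rk (head d) = (rk (tail d)).+1 else rk (tail d) = (rk (head
    d)).+1.
Proof. by case: d => e []; rewrite /head /tail /= rk_edge. Qed.

(** Subtracting the equation of the arc from that of the small circle leaves a linear one. A common
    point on the spine would be the other end of the arc, at distance at least 1. *)
Lemma dart_point (d : dart A) (eps : R) p : 0 < eps -> eps < 1 ->
    sqdist p (vertex_point R pi (tail d)) = eps ^+ 2 ->
      edge_arc pi sigma d.1 p ->
  [/\ p.1 ^+ 2 + (p.2 - height (tail d)) ^+ 2 = eps ^+ 2,
      (height (head d) - height (tail d)) * (p.2 - height (tail d)) = eps ^+ 2
    & if odd (rk (tail d)) == d.2 then 0 < p.1 else p.1 < 0].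
Proof.
move=> e0 e1; rewrite /sqdist /= subr0 => circ /edge_arcE[arc side].
have prod : (height (head d) - height (tail d)) * (p.2 - height (tail d)) = eps
  ^+ 2.
  by move: circ arc; rewrite /head /tail /=; case: (d.2) => /=; lra.
split=> //; rewrite dart_page in side.
suff : p.1 != 0 by case: ifP side => _; rewrite lt_neqAle => -> ;
  rewrite andbT // eq_sym.
apply/eqP => p0; rewrite p0 expr0n add0r in circ.
have gap := dart_gap d; set L := _ - _ in prod gap; set Y := _ - _ in prod circ.
have Y0 : Y != 0 by apply/eqP => Y0; rewrite Y0 expr0n /= in circ; nra.
have LY : L = Y.
  by apply: (mulIf Y0); rewrite prod -circ expr2.
by case: d.2 gap => gap; nra.
Qed.

Lemma dart_quadrant (d : dart A) (eps : R) p : 0 < eps -> eps < 1 ->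
    sqdist p (vertex_point R pi (tail d)) = eps ^+ 2 ->
      edge_arc pi sigma d.1 p ->
  ucoord (tail d) p ^+ 2 + wcoord (tail d) p ^+ 2 = eps ^+ 2 /\
  quadrant d.2 (ucoord (tail d) p) (wcoord (tail d) p).
Proof.
move=> e0 e1 circ arc; have [c prod side] := dart_point e0 e1 circ arc.
have gap := dart_gap d; have E0 : 0 < eps ^+ 2 by rewrite exprn_gt0.
have Y2 : if d.2 then 0 < p.2 - height (tail d) else p.2 - height (tail d) < 0.
  by case: d.2 gap => gap; nra.
rewrite /ucoord /wcoord; move: side Y2; case: odd; case: d.2 => /= side Y2;
  split; lra.
Qed.

(** By [dart_point], the vertical offset on the small circle is inversely proportional to the height
    difference of the dart, so the arc with the farther head starts flatter. *)
Lemma dart_quadrant_lt (d d' : dart A) (eps : R) p p' : 0 < eps -> eps < 1 ->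
    tail d' = tail d -> ccw_step x d d' ->
    sqdist p (vertex_point R pi (tail d)) = eps ^+ 2 ->
      edge_arc pi sigma d.1 p ->
    sqdist p' (vertex_point R pi (tail d)) = eps ^+ 2 ->
      edge_arc pi sigma d'.1 p' ->
  quadrant_lt d.2 (wcoord (tail d) p) d'.2 (wcoord (tail d) p').
Proof.
move=> e0 e1 dd' st circ arc; rewrite -{1}dd' => circ' arc'.
have [c prod side] := dart_point e0 e1 circ arc.
have [c' prod' side'] := dart_point e0 e1 circ' arc'.
have E0 : 0 < eps ^+ 2 by rewrite exprn_gt0.
have gap := dart_gap d; have gap' := dart_gap d'.
rewrite dd' in c' prod' side' gap'.
(* Both heads are on a level whose parity is opposite to that of the tail, and its direction of
   traversal translates [ccw_step] into heights. *)
have ord : d.2 = d'.2 -> if odd (rk (tail d)) == d.2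
    then height (head d') < height (head d) else height (head d) < height (head
      d').
  move=> dd2; have rkd := rk_head d; have rkd' := rk_head d'.
  rewrite dd' in rkd'; rewrite !lt_height /before.
  by move: st dd2 rkd rkd'; rewrite /ccw_step; case: d.2;
    case: d'.2 => // lt _ rd rd';
    rewrite ?rd ?(succn_inj (etrans (esym rd) rd')) ?rd' ?ltnn ?eqxx /=;
      case: odd.
move: st ord gap gap' prod prod' side side'.
rewrite /ccw_step /wcoord; set Y := _ - _ in c *; set Y' := _ - _ in c' *.
set h := height (tail d); set H := height (head d); set H' := height (head d').
case: d.2; case: d'.2 => // st /(_ erefl);
  case: odd => /= lt gap gap' prod prod' side side'.
- by apply: (inv_lt E0 prod' prod); [apply: mulr_gt0 | ]; lra.
(* On even levels [wcoord] is [- p.1], so the offsets are compared through the equation of the small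
   circle. *)
- have Y'Y : Y' < Y by apply: (inv_lt E0 prod prod'); [apply: mulr_gt0 | ]; lra.
  have Y'0 : 0 < Y' by rewrite -(pmulr_rgt0 Y' (lt_le_trans ltr01 gap')) prod'.
  have := mulr_gt0 Y'0 Y'0; have : 0 < (Y - Y') * (Y + Y') by apply: mulr_gt0;
    lra.
  nra.
- by apply: (inv_lt E0 prod prod'); [rewrite nmulr_rgt0 | ]; lra.
- have YY' : Y < Y' by apply: (inv_lt E0 prod' prod); [rewrite nmulr_rgt0 | ];
  lra.
  have Y'0 : Y' < 0.
    by rewrite -(nmulr_rgt0 Y' (le_lt_trans gap' (ltrN10 R))) prod'.
  have : 0 < (Y' - Y) * (- Y - Y') by apply: mulr_gt0; lra.
  nra.
Qed.

Lemma ccw_coord v (p q r : R * R) :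
  0 < (ucoord v q - ucoord v p) * (wcoord v r - wcoord v p)
    - (wcoord v q - wcoord v p) * (ucoord v r - ucoord v p) -> ccw p q r.
Proof. by rewrite /ccw /ucoord /wcoord; case: odd; congr (_ < _); ring. Qed.

(** Since [ccw] is invariant under cyclic shifts, each case of [perm_cyclic_order] reduces to three
    darts in the order [ccw_step]. *)
Lemma level_rotation (rot : {perm dart A}) : rotation_system rot ->
    (forall d d', tail d = tail d' -> ~~ ccw_step x d (rot d) ->
      ~~ ccw_step x d' (rot d') -> d = d') ->
  rotation_of_drawing R pi sigma rot.
Proof.
move=> rotS step_inj d d' d'd neq neqr; near=> eps => p q r.
have e0 : 0 < eps by [].
have e1 : eps < 1 by near: eps; apply: nbhs_right_lt.
have tail_rot : tail (rot d) = tail d.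
  by apply/eqP; rewrite -rotS -eq_porbit_mem porbit_step.
pose S := @ccw_step V A x.
have ccw3 a b c pa pb pc : tail a = tail d -> tail b = tail d ->
  tail c = tail d ->
    S a b && S b c ->
    sqdist pa (vertex_point R pi (tail d)) = eps ^+ 2 ->
      edge_arc pi sigma a.1 pa ->
    sqdist pb (vertex_point R pi (tail d)) = eps ^+ 2 ->
      edge_arc pi sigma b.1 pb ->
    sqdist pc (vertex_point R pi (tail d)) = eps ^+ 2 ->
      edge_arc pi sigma c.1 pc ->
  ccw pa pb pc.
  move=> <- ba ca /andP[ab bc] sa aa sb ab' sc ac.
  have [ua qa] := dart_quadrant e0 e1 sa aa.
  have [ub qb] : ucoord (tail a) pb ^+ 2 + wcoord (tail a) pb ^+ 2 = eps ^+ 2 /\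
    quadrant b.2 (ucoord (tail a) pb) (wcoord (tail a) pb).
    by rewrite -ba in sb *; apply: dart_quadrant.
  have [uc qc] : ucoord (tail a) pc ^+ 2 + wcoord (tail a) pc ^+ 2 = eps ^+ 2 /\
    quadrant c.2 (ucoord (tail a) pc) (wcoord (tail a) pc).
    by rewrite -ca in sc *; apply: dart_quadrant.
  have lab := dart_quadrant_lt e0 e1 ba ab sa aa sb ab'.
  have lbc : quadrant_lt b.2 (wcoord (tail a) pb) c.2 (wcoord (tail a) pc).
    rewrite -ba in ca sb sc *;
      exact: (dart_quadrant_lt e0 e1 ca bc sb ab' sc ac).
  exact: ccw_coord (quadrant_ccw ua ub uc qa qb qc lab lbc).
move=> sp ap sq aq sr ar.
have bad : {in porbit rot d &, forall y z,
  ~~ S y (rot y) -> ~~ S z (rot z) -> y = z}.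
  by move=> y z; rewrite !rotS => /eqP yd /eqP zd; apply: step_inj;
    rewrite yd zd.
have d'in : d' \in porbit rot d by rewrite rotS d'd.
have [st|st|st] := perm_cyclic_order (@ccw_step_trans V A x) bad d'in neq neqr.
- by apply: (ccw3 d (rot d) d').
- by apply/ccw_rot/ccw_rot; apply: (ccw3 (rot d) d' d).
- by apply/ccw_rot; apply: (ccw3 d' d (rot d)).
Unshelve. all: by end_near.
Qed.

(** * The external region *)

Lemma external_ray (D : set (R * R)) (q : R * R) :
  (forall z, z.1 <= q.1 -> z.2 = q.2 -> ~ D z) ->
  ~ bounded_set (connected_component (~` D)%classic q).
Proof.
move=> ray bnd; have [M _ bd] := pinfty_ex_gt (num_real 0) bnd.
have conn : connected ((fun a : R => (a, q.2)) @` [set a | a <= q.1])%classic.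
  apply: connected_continuous_connected.
    by apply/connected_intervalP => a b /= _ bq c /andP[_ cb];
      exact: (le_trans cb bq).
  apply: continuous_subspaceT => a;
    by apply: (@cvg_pair _ _ _ _ (nbhs a) (nbhs q.2));
      [exact: cvg_id | exact: cvg_cst].
(* A point of the leftward ray from [q] whose norm exceeds [M]. *)
pose a := - (`|q.1| + `|M| + 1).
have aq : a <= q.1 by rewrite /a; have := ler_norm (- q.1); rewrite normrN;
  have := normr_ge0 M; lra.
have /bd /= : connected_component (~` D)%classic q (a, q.2).
  apply: connected_component_max conn _ _.
  - by exists q.1 => //=; case: (q).
  - by move=> z [b /= bq <-]; apply: ray.
  - by exists a.
apply/negP; rewrite -ltNge ProdNormedZmodule.prod_normE /= lt_max; apply/orP;
  left.
rewrite /a normrN ger0_norm; last by have := normr_ge0 M; have := normr_ge0 q.1;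
  lra.
by have := ler_norm M; have := normr_ge0 q.1; lra.
Qed.

(** The leftmost vertex of level 1 is the last of its level on the spine, so no left arc from the
    bottom vertex reaches beyond that of [e]. All other left arcs start at level 2 or above, higher
    than [tgt e]. Leftward rays from outside the arc of [e], close to its middle, thus avoid the
    drawing. *)
Lemma level_external (e : edge A) : rk (src e) = 0%N -> x (tgt e) = 0%N ->
  (forall v, rk v = 0%N -> v = src e) -> external_on_left R pi sigma (e, true).
Proof.
move=> rk0 x0 bottom; set hs := height (src e); set ht := height (tgt e).
have gap : hs + 1 <= ht := height_gap (edge_before e).
(* The leftmost point of the arc. *)
exists (- (ht - hs) / 2, (hs + ht) / 2); split=> /=.
- apply/edge_arcE; rewrite rk0 /= -/hs -/ht; split; lra.
- by rewrite lt_eqF //; lra.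
rewrite /left_side /level_page rk0 /=.
(* The arc has radius at least 1/2, so in the max norm this ball keeps [q.1] negative and [q.2]
   between [hs] and [ht]. *)
apply/nbhs_ballP; exists (2^-1) => /=; first by rewrite invr_gt0.
move=> q [/= b1 b2]; rewrite -ball_normE /= in b1; rewrite -ball_normE /= in b2.
move: b1 b2; rewrite !ltr_norml => /andP[b1 b1'] /andP[b2 b2'].
rewrite /sqdist /arc_radius /arc_center /= -/hs -/ht => out.
apply: external_ray => z zq1 zq2 [[v _ vz]|[e' _ /edge_arcE[arc side]]].
  by move: zq1; rewrite -vz /=; lra.
have z1 : z.1 < 0 by lra.
have pg : odd (rk (src e')) = false.
  by apply: negbTE; apply/negP => od; move: side; rewrite od leNgt z1.
set hs' := height (src e') in arc; set ht' := height (tgt e') in arc.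
have gap' : hs' + 1 <= ht' := height_gap (edge_before e').
have between : hs' < z.2 < ht' by apply/andP; split; nra.
case/andP: between => zs zt.
have [r0|rn0] := eqVneq (rk (src e')) 0%N.
  have es : src e' = src e := bottom _ r0.
  have top : ht' <= ht.
    by rewrite leNgt lt_height /before !rk_edge rk0 r0 /= x0.
  have hh : hs' = hs by rewrite /hs' es.
  rewrite zq2 in arc zs zt; rewrite hh in arc zs zt.
  have sq : q.1 ^+ 2 <= z.1 ^+ 2 by nra.
  have : 0 <= (q.2 - hs) * (ht - ht') by apply: mulr_ge0; lra.
  clear - out arc sq; lra.
have ge2 : (1 < rk (src e'))%N by move: pg rn0; case: (rk _) => [|[]].
have : ht + 1 <= hs'.
  by apply: height_gap; rewrite /before rk_edge rk0 ge2.
lra.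
Qed.

End Drawing.

Theorem theorem4 (R : realType) (V : finType) (A : rel V) (s t : V)
    (rot : {perm dart A}) (outer : {set dart A}) :
  plane_st_graph rot s t outer ->
  (forall f : {set dart A}, f \in faces rot -> f <> outer -> rhombus rot f) ->
  exists (pi : V -> 'I_#|V|) (sigma : edge A -> page),
    is_2UBE pi sigma /\ embedding_preserving R pi sigma rot outer.
Proof.
move=> plane rhomb.
have [rk [x [rk_edge rk_x_inj edge_mono step_inj outerP]]] := leveling plane
  rhomb.
have [pi [pi_bij piE]] := rank_by_key (key_inj rk_x_inj).
have pi_lt u v : (pi u < pi v)%N = before rk x u v by rewrite piE key_lt.
exists pi, (@level_page V A rk); split;
  first exact: level_2UBE edge_mono _ pi_bij pi_lt.
split; first by case: plane => _ rotS _ _ _;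
  apply: level_rotation rotS step_inj.
case: outerP => [->|[e [eo rk0 x0 bottom]]]; [by left | right].
by exists (e, true) => //; apply: level_external.
Qed.
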